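(* If $m\ge 3$ is an integer, then $\mathrm{DOM}_t(K_2 \Box P_m) \geq \left\lfloor \frac{3}{2}m \right\rfloor +1$.
   Context: An orientation of a (finite simple) graph $G$ is a digraph obtained by directing each edge $uv$ of $G$ in exactly one of the two directions $(u,v)$ or $(v,u)$. The orientation is valid if every vertex has in-degree at least $1$. A set $S\subseteq V(D)$ is a total dominating set of a digraph $D$ if every vertex of $D$ (including those in $S$) has an in-neighbor in $S$; $\gamma_t(D)$ is the minimum cardinality of a total dominating set of $D$. For a graph $G$ in which every component contains a cycle (equivalently, $G$ has a valid orientation), $\mathrm{DOM}_t(G)$ is the maximum of $\gamma_t(D)$ over all valid orientations $D$ of $G$. $P_m$ is the path on $m$ vertices, $K_2$ is the complete graph on two vertices, and $G\Box H$ is the Cartesian product: vertex set $V(G)\times V(H)$, with $(g,h)$ adjacent to $(g',h')$ iff either $g=g'$ and $hh'\in E(H)$, or $gg'\in E(G)$ and $h=h'$. *)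

(* Defs.v *)
From mathcomp Require Import all_boot.

Set Implicit Arguments.
Unset Strict Implicit.
Unset Printing Implicit Defensive.

Structure sgraph := SGraph {
  vertex :> finType;
  edge : rel vertex;
  edge_sym : symmetric edge;
  edge_irrefl : irreflexive edge
}.

(* The arc (u, v), directed from u to v, is in the digraph D iff (u, v) \in D. *)
Definition digraph (T : finType) := {set T * T}.

Definition orientation (G : sgraph) (D : digraph G) : bool :=
  [forall u, forall v,
     if edge u v then ((u, v) \in D) (+) ((v, u) \in D) else (u, v) \notin D].

Definition valid (T : finType) (D : digraph T) : bool :=
  [forall v, 0 < #|[set u | (u, v) \in D]|].

Definition total_dominating (T : finType) (D : digraph T) (S : {set T}) : bool :=
  [forall v, exists u in S, (u, v) \in D].

(* Meaningful for valid D: then the full vertex set is total dominating, so it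
   is a legitimate starting candidate for the minimum. *)
Definition gamma_t (T : finType) (D : digraph T) : nat :=
  #|[arg min_(S < [set: T] | total_dominating D S) #|S| ]|.

(* Equal to 0 when G has no valid orientation. *)
Definition DOM_t (G : sgraph) : nat :=
  \max_(D : digraph G | orientation D && valid D) gamma_t D.

Definition path_rel (m : nat) : rel 'I_m :=
  fun i j => (i.+1 == j :> nat) || (j.+1 == i :> nat).

Lemma path_rel_sym m : symmetric (@path_rel m).
Proof. by move=> i j; rewrite /path_rel orbC. Qed.

Lemma path_rel_irrefl m : irreflexive (@path_rel m).
Proof. by move=> i; rewrite /path_rel orbb gtn_eqF. Qed.

Definition path_graph (m : nat) : sgraph :=
  SGraph (@path_rel_sym m) (@path_rel_irrefl m).

Definition complete_rel (n : nat) : rel 'I_n := fun i j => i != j.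

Lemma complete_rel_sym n : symmetric (@complete_rel n).
Proof. by move=> i j; rewrite /complete_rel eq_sym. Qed.

Lemma complete_rel_irrefl n : irreflexive (@complete_rel n).
Proof. by move=> i; rewrite /complete_rel eqxx. Qed.

Definition complete_graph (n : nat) : sgraph :=
  SGraph (@complete_rel_sym n) (@complete_rel_irrefl n).

Definition cartesian_rel (G H : sgraph) : rel (G * H)%type :=
  fun x y => ((x.1 == y.1) && edge x.2 y.2) || (edge x.1 y.1 && (x.2 == y.2)).

Lemma cartesian_rel_sym G H : symmetric (@cartesian_rel G H).
Proof.
move=> x y; rewrite /cartesian_rel (eq_sym x.1) (eq_sym x.2).
by rewrite (edge_sym x.1) (edge_sym x.2).
Qed.

Lemma cartesian_rel_irrefl G H : irreflexive (@cartesian_rel G H).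
Proof. by move=> x; rewrite /cartesian_rel !edge_irrefl andbF. Qed.

Definition cartesian_product (G H : sgraph) : sgraph :=
  SGraph (@cartesian_rel_sym G H) (@cartesian_rel_irrefl G H).

(* Main.v *)
Require Import Defs.
From mathcomp Require Import all_boot zify.

Set Implicit Arguments.
Unset Strict Implicit.
Unset Printing Implicit Defensive.

(** The bound is reached by one explicit orientation of the ladder. Write [a_i]
    and [b_i] for the vertices of column [i], [0 <= i < m], in rows [0] and [1].
    The perimeter is a directed cycle, running to the right along row [0] and
    back along row [1], and the inner rungs alternate: from [a_i] to [b_i] for
    odd [i], from [b_i] to [a_i] for even [i].

    A total dominating set meets every in-neighbourhood, so it is at least as
    large as any family of pairwise disjoint in-neighbourhoods
    ([card_le_total_dominating]). On the bare perimeter cycle the [2m]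
    in-neighbourhoods are distinct singletons; each inner rung enlarges one of
    them and thereby creates overlaps. Alternation makes the overlaps of
    neighbouring rungs coincide: for inner columns [i] odd and [i+1], the
    vertices [b_i] and [a_(i+1)] both have in-neighbourhood
    [{a_i, b_(i+1)}], which is disjoint from all the others. So discarding
    [b_i] for every odd inner column [i] restores disjointness
    ([private_out_uniq]). There are [(m-1)/2] such columns, rounded down, and
    the [2m - (m-1)/2 = 3m/2 + 1] remaining vertices, with both quotients
    rounded down, give the bound ([card_private]). *)

(** * Total domination and packings of in-neighbourhoods *)

Section TotalDomination.
Variable T : finType.
Implicit Types (D : digraph T) (S W : {set T}).

(** The hypothesis says that the in-neighbourhoods of the vertices of [W] are
    pairwise disjoint; [S] needs a separate element in each of them. *)
Lemma card_le_total_dominating D S W :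
  (forall u v w, v \in W -> w \in W -> (u, v) \in D -> (u, w) \in D -> v = w) ->
  total_dominating D S -> #|W| <= #|S|.
Proof.
move=> uniq_out /forallP domS.
pose f u := odflt u [pick v in W | (u, v) \in D].
apply: leq_trans (leq_imset_card f S); apply/subset_leq_card/subsetP => v vW.
have /existsP[u /andP[uS uv]] := domS v.
apply/imsetP; exists u => //; rewrite /f.
case: pickP => [w /andP[wW uw] | /(_ v)]; first exact: uniq_out vW wW uv uw.
by rewrite vW uv.
Qed.

Lemma total_dominating_setT D : valid D -> total_dominating D [set: T].
Proof.
move=> /forallP validD; apply/forallP => v.
have /card_gt0P[u] := validD v; rewrite inE => uv.
by apply/existsP; exists u; rewrite in_setT.
Qed.

Lemma leq_gamma_t D k : valid D ->
  (forall S, total_dominating D S -> k <= #|S|) -> k <= gamma_t D.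
Proof.
move=> /total_dominating_setT domT lek; rewrite /gamma_t.
by case: arg_minnP => // S domS _; apply: lek.
Qed.

End TotalDomination.

Lemma leq_DOM_t (G : sgraph) (D : digraph G) k :
  orientation D -> valid D ->
  (forall S, total_dominating D S -> k <= #|S|) -> k <= DOM_t G.
Proof.
move=> oD vD lek; apply: leq_trans (leq_gamma_t vD lek) _.
by rewrite /DOM_t (bigD1 D) ?oD ?vD //= leq_maxl.
Qed.

(** * The alternating orientation of the ladder *)

Section Ladder.
Variable n : nat.
Let m := n.+1.

Definition ladder := cartesian_product (complete_graph 2) (path_graph m).

(** The last rung closes the perimeter cycle and so points away from row [0]
    whatever the parity of its column; the first one is already directed
    correctly, its index being even. *)
Definition rung_down (i : nat) : bool := odd i || (i.+1 == m).

Definition ladder_arc (u v : ladder) : bool :=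
  if u.1 == v.1 :> 'I_2 then
    if u.1 == ord0 :> 'I_2 then u.2.+1 == v.2 :> nat else v.2.+1 == u.2 :> nat
  else (u.2 == v.2 :> nat) && ((u.1 == ord0 :> 'I_2) == rung_down u.2).

Definition ladder_orientation : digraph ladder :=
  [set p | ladder_arc p.1 p.2].

(** All vertices except [b_i] for the odd inner columns [i]; no vertex has arcs
    to two of them. *)
Definition private : {set ladder} :=
  [set v : ladder | (v.1 == ord0 :> 'I_2) || ~~ odd v.2 || (v.2.+1 == m)].

Lemma I2_cases (r : 'I_2) : r = ord0 \/ r = ord_max.
Proof. by case: r => [[|[|//]] lt_r]; [left|right]; apply: val_inj. Qed.

Lemma ladder_orientationP : orientation ladder_orientation.
Proof.
apply/forallP => -[r i]; apply/forallP => -[s j].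
rewrite !inE /ladder_arc /edge /= /cartesian_rel /= /path_rel /complete_rel.
rewrite -(inj_eq val_inj i j) /=.
case: (I2_cases r) => ->; case: (I2_cases s) => -> /=.
- by case: ifP; lia.
- by have [->|] := eqVneq (i : nat) j; rewrite ?eqxx //=; case: rung_down.
- by have [->|] := eqVneq (i : nat) j; rewrite ?eqxx //=; case: rung_down.
- by case: ifP; lia.
Qed.

(** The perimeter cycle alone enters every vertex. *)
Lemma ladder_valid : 2 <= m -> valid ladder_orientation.
Proof.
move=> m_ge2; apply/forallP => -[s j]; apply/card_gt0P.
have ltj := ltn_ord j; case: (I2_cases s) => ->.
  have [j0|j_gt0] := posnP j.
    exists (ord_max, j); rewrite !inE /ladder_arc -!val_eqE /= /rung_down; lia.
  have ltj' : j.-1 < m by lia.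
  exists (ord0, Ordinal ltj'); rewrite !inE /ladder_arc -!val_eqE /=; lia.
have [jm|j_lt] := eqVneq j.+1 m.
  exists (ord0, j); rewrite !inE /ladder_arc -!val_eqE /= /rung_down; lia.
have ltj' : j.+1 < m by lia.
exists (ord_max, Ordinal ltj'); rewrite !inE /ladder_arc -!val_eqE /=; lia.
Qed.

(** The out-neighbours of an inner vertex are its successor on the perimeter
    and possibly the other end of its rung. From [a_i] the rung is used for
    odd [i] only, and then [b_i] is not private; from [b_i] it is used for
    even [i] only, and then the successor [b_(i-1)] is not private.
    At the four corners the rung, if it is an out-arc, is the perimeter arc. *)
Lemma private_out_uniq (u v w : ladder) :
  v \in private -> w \in private ->
  (u, v) \in ladder_orientation -> (u, w) \in ladder_orientation -> v = w.
Proof.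
case: u v w => [r i] [s j] [t k]; rewrite !inE /ladder_arc -!val_eqE /= /rung_down.
have := ltn_ord i; have := ltn_ord j; have := ltn_ord k.
case: (I2_cases r) => ->; case: (I2_cases s) => ->; case: (I2_cases t) => -> /=;
  move=> *; try (by congr pair; apply: val_inj => /=; lia); exfalso; lia.
Qed.

Lemma card_private : 2 * m - m.-1./2 <= #|private|.
Proof.
have <- : #|ladder| = 2 * m by rewrite card_prod !card_ord.
rewrite -(cardsC private) leq_subLR addnC leq_add2r.
(* The columns losing a vertex are the odd numbers 2k+1 with k < (m-1)/2. *)
pose f (k : 'I_(m.-1./2)) : ladder := (ord_max, inord k.*2.+1).
rewrite -[X in _ <= X]card_ord; apply: leq_trans (leq_imset_card f _).
apply/subset_leq_card/subsetP => -[s j]; rewrite !inE -!val_eqE /= => js.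
have ltj := ltn_ord j; have ltk : j./2 < m.-1./2 by rewrite /m in ltj js *; lia.
apply/imsetP; exists (Ordinal ltk); rewrite // /f /=; congr pair.
  by case: (I2_cases s) js => ->.
by apply: val_inj; rewrite /= inordK; rewrite /m in ltj js *; lia.
Qed.

End Ladder.

Theorem theorem4p10 (m : nat) (hm : 3 <= m) :
  (3 * m) %/ 2 + 1 <= DOM_t (cartesian_product (complete_graph 2) (path_graph m)).
Proof.
case: m hm => // n hm.
apply: (leq_DOM_t (ladder_orientationP n) (ladder_valid (ltnW hm))) => S domS.
apply: leq_trans (card_le_total_dominating (@private_out_uniq n) domS).
by apply: leq_trans (card_private n); lia.
Qed.
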